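(* Let $G_1,\dots,G_m$ be finite groups and $H\subset G_1\times\cdots\times G_m$ a subgroup, acting on $m$-party systems by tensor products of local projective unitary representations. Suppose that the state $\Gamma_H$ can be freely introduced by the primitive-level theory. Then every finite-round $H$-covariant LOCC channel admits an exact implementation using $H$-symmetric local primitives. Consequently, $$\mathfrak{O}_{\mathrm{prim},H}=\mathfrak{O}_{\mathrm{covLOCC},H}.$$
   Context: The input and output systems of party $i$ are finite-dimensional and carry projective unitary representations $U_i,U'_i$ of $G_i$; for $\boldsymbol{g}=(g_1,\dots,g_m)\in H$, $U(\boldsymbol{g})=\bigotimes_iU_i(g_i)$ and $U'(\boldsymbol{g})=\bigotimes_iU'_i(g_i)$. A channel $\mathcal{E}$ is $H$-covariant if $\mathcal{E}(U(\boldsymbol{g})LU(\boldsymbol{g})^\dagger)=U'(\boldsymbol{g})\mathcal{E}(L)U'(\boldsymbol{g})^\dagger$ for all $\boldsymbol{g}\in H$ and all $L$. $\mathfrak{O}_{\mathrm{covLOCC},H}$ is the class of finite-round LOCC channels among the $m$ parties that are $H$-covariant (LOCC realizations are composed of local state introductions, local unitaries, local measurements, classical communication, operations conditioned on the classical transcript, and discarding). Primitive-level theory: $\mathfrak{O}_{\mathrm{prim},H}$ is the class of channels generated by finitely many steps of the following: (1) local unitaries at a party that commute with the representation of $H$ on the party's current quantum systems (party $i$'s systems carry projective unitary representations of $G_i$, and $\boldsymbol{g}\in H$ acts at party $i$ through $g_i$); (2) local projective measurements all of whose projections commute with that representation; (3) introduction of local ancillary states that are invariant under the symmetry, on ancillary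 systems carrying arbitrary projective unitary representations; (4) classical communication and classical control, where all classical registers (measurement outcomes, transcript) transform trivially under $H$; no quantum systems and no nontrivially transforming classical registers are transmitted; (5) discarding of local subsystems. ''The state $\Gamma_H$ can be freely introduced'' means that the introduction of $\Gamma_H$ below, shared among the parties, is also an allowed step. Reference state: party $i$ has a register with orthonormal basis $\{|\xi_{g_i}\rangle\}_{g_i\in G_i}$ carrying the left regular representation of $G_i$, and $\Gamma_H:=\frac{1}{|H|}\sum_{\boldsymbol{g}\in H}\bigotimes_{i=1}^m|\xi_{g_i}\rangle\langle\xi_{g_i}|$. *)

(* Defs.v *)
From HB Require Import structures.
From mathcomp Require Import all_boot all_order all_algebra all_fingroup.
From mathcomp Require Import all_solvable.
From mathcomp Require Export reals complex.
Set Implicit Arguments.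
Unset Strict Implicit.
Unset Printing Implicit Defensive.
Import Order.TTheory GRing.Theory Num.Theory.
Local Open Scope ring_scope.
Local Open Scope sesquilinear_scope.

(* The complex numbers are R[i] for R : realType.  A finite-dimensional Hilbert
   space is given by the finite type labelling an orthonormal basis, so that
   tensor products are product types. *)
Section Operators.
Variable R : realType.

Definition op (T : finType) := 'M[R[i]]_#|T|.

Definition mkop (T : finType) (F : T -> T -> R[i]) : op T :=
  \matrix_(i, j) F (enum_val i) (enum_val j).

Definition ent (T : finType) (X : op T) (x y : T) : R[i] :=
  X (enum_rank x) (enum_rank y).

Lemma mkopE (T : finType) (F : T -> T -> R[i]) x y : ent (mkop F) x y = F x y.
Proof. by rewrite /ent mxE !enum_rankK. Qed.

Lemma opP (T : finType) (X Y : op T) :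
  (forall x y, ent X x y = ent Y x y) -> X = Y.
Proof.
move=> eqXY; apply/matrixP => i j.
by have := eqXY (enum_val i) (enum_val j); rewrite /ent !enum_valK.
Qed.

Lemma entM (T : finType) (X Y : op T) x y :
  ent (X *m Y) x y = \sum_z ent X x z * ent Y z y.
Proof.
rewrite /ent mxE (reindex (@enum_rank T)) //=.
by exists enum_val => ? _; rewrite ?enum_rankK ?enum_valK.
Qed.

Lemma ent1 (T : finType) x y : ent (1%:M : op T) x y = (x == y)%:R.
Proof. by rewrite /ent mxE (inj_eq enum_rank_inj). Qed.

Lemma ent_adj (T : finType) (X : op T) x y : ent (X ^t*) x y = (ent X y x)^*.
Proof. by rewrite /ent !mxE. Qed.

Lemma entZ (T : finType) c (X : op T) x y : ent (c *: X) x y = c * ent X x y.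
Proof. by rewrite /ent mxE. Qed.

(* In R[i], 0 <= z forces z to be real, so this also makes rho hermitian. *)
Definition density (T : finType) (rho : op T) : Prop :=
  (forall v : 'cV[R[i]]_#|T|, 0 <= (v ^t* *m rho *m v) 0 0) /\ \tr rho = 1.

Definition conjop (T : finType) (K X : op T) : op T := K *m X *m K ^t*.

Definition tensop (S T : finType) (X : op S) (Y : op T) : op (S * T)%type :=
  mkop (fun x y => ent X x.1 y.1 * ent Y x.2 y.2).

Definition kraus_complete (T O : finType) (M : O -> op T) : Prop :=
  \sum_k (M k) ^t* *m M k = 1%:M.

Definition projective_measurement (T O : finType) (P : O -> op T) : Prop :=
  [/\ forall k, (P k) ^t* = P k, forall k, P k *m P k = P k
    & \sum_k P k = 1%:M].

End Operators.

Section ProjectiveRepresentations.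
Variable R : realType.

(* Homomorphisms to the projective unitary group: the multiplier c depends on
   (g, h) and no normalization of rep 1 is imposed. *)
Record prep (gT : finGroupType) := Prep {
  carrier :> finType;
  rep : gT -> op R carrier;
  rep_unitary : forall g, rep g \is unitarymx;
  rep_mul : forall g h : gT,
    exists2 c : R[i], `|c| = 1 & rep g *m rep h = c *: rep (g * h)%g
}.

Variable gT : finGroupType.

Lemma tensop_mul (S T : finType) (X X' : op R S) (Y Y' : op R T) :
  tensop X Y *m tensop X' Y' = tensop (X *m X') (Y *m Y').
Proof.
apply: opP => -[x y] [x' y']; rewrite entM mkopE /= !entM big_distrlr /=.
rewrite pair_bigA; apply: eq_bigr => -[z t] _.
by rewrite !mkopE /= mulrACA.
Qed.

Lemma tensop_adj (S T : finType) (X : op R S) (Y : op R T) :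
  (tensop X Y) ^t* = tensop (X ^t*) (Y ^t*).
Proof. by apply: opP => x y; rewrite ent_adj !mkopE !ent_adj rmorphM. Qed.

Lemma tensop1 (S T : finType) :
  tensop (1%:M : op R S) (1%:M : op R T) = 1%:M.
Proof.
apply: opP => -[x y] [x' y'].
by rewrite mkopE /= !ent1 -natrM mulnb.
Qed.

Section Tensor.
Variables A K : prep gT.

Definition tens_rep g : op R (A * K)%type := tensop (rep A g) (rep K g).

Lemma tens_rep_unitary g : tens_rep g \is unitarymx.
Proof.
apply/unitarymxP; rewrite tensop_adj tensop_mul.
by rewrite !(unitarymxP (rep_unitary _ _)) tensop1.
Qed.

Lemma tens_rep_mul g h :
  exists2 c : R[i], `|c| = 1
    & tens_rep g *m tens_rep h = c *: tens_rep (g * h)%g.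
Proof.
have [c c1 Ec] := rep_mul A g h; have [d d1 Ed] := rep_mul K g h.
exists (c * d); first by rewrite normrM c1 d1 mulr1.
rewrite tensop_mul Ec Ed; apply: opP => x y.
by rewrite entZ !mkopE !entZ mulrACA.
Qed.

Definition tens_prep : prep gT := Prep tens_rep_unitary tens_rep_mul.

End Tensor.

Definition reg_rep (g : gT) : op R gT := mkop (fun x y => (x == (g * y)%g)%:R).

Lemma reg_repM g h : reg_rep g *m reg_rep h = reg_rep (g * h)%g.
Proof.
apply: opP => x y; rewrite entM mkopE (bigD1 (h * y)%g) //= !mkopE eqxx mulr1.
rewrite big1 ?addr0 ?mulgA // => z /negPf nz.
by rewrite !mkopE nz mulr0.
Qed.

Lemma reg_rep_unitary g : reg_rep g \is unitarymx.
Proof.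
apply/unitarymxP.
have -> : (reg_rep g) ^t* = reg_rep (g^-1)%g.
  apply: opP => x y; rewrite ent_adj !mkopE rmorph_nat.
  congr ((_ : bool)%:R).
  by apply/eqP/eqP => ->; rewrite ?mulKg ?mulKVg.
by rewrite reg_repM mulgV; apply: opP => x y; rewrite ent1 mkopE mul1g.
Qed.

Lemma reg_rep_mul g h :
  exists2 c : R[i], `|c| = 1 & reg_rep g *m reg_rep h = c *: reg_rep (g * h)%g.
Proof. by exists 1; rewrite ?normr1 // scale1r reg_repM. Qed.

Definition reg_prep : prep gT := Prep reg_rep_unitary reg_rep_mul.

End ProjectiveRepresentations.

Section Multipartite.
Variables (R : realType) (m : nat).

(* Product basis of the tensor product of the parties' spaces. *)
Definition glob (A : 'I_m -> finType) : finType := {dffun forall i, A i}.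

Definition gop (A : 'I_m -> finType) := op R (glob A).

Definition tens (A : 'I_m -> finType) (u : forall i, op R (A i)) : gop A :=
  mkop (fun x y : glob A => \prod_i ent (u i) (x i) (y i)).

Definition adjoin (A K : 'I_m -> finType) : 'I_m -> finType :=
  fun i => (A i * K i)%type.

Section Adjoin.
Variables A K : 'I_m -> finType.

Definition gpair (x : glob A) (k : glob K) : glob (adjoin A K) :=
  finfun (fun i => (x i, k i) : adjoin A K i).
Definition gfst (z : glob (adjoin A K)) : glob A :=
  finfun (fun i => (z i).1 : A i).
Definition gsnd (z : glob (adjoin A K)) : glob K :=
  finfun (fun i => (z i).2 : K i).

Definition introduce (sigma : gop K) (X : gop A) : gop (adjoin A K) :=
  mkop (fun z w => ent X (gfst z) (gfst w) * ent sigma (gsnd z) (gsnd w)).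

(* Partial trace over all the K i. *)
Definition discard (X : gop (adjoin A K)) : gop A :=
  mkop (fun x y => \sum_k ent X (gpair x k) (gpair y k)).

End Adjoin.

(* Renaming of the parties' bases (e.g. reordering of tensor factors). *)
Definition relabel (A A' : 'I_m -> finType) (f : forall i, A' i -> A i)
    (X : gop A) : gop A' :=
  let F (x : glob A') : glob A := finfun (fun i => f i (x i) : A i) in
  mkop (fun x y => ent X (F x) (F y)).

(* [locc A B Phi]: some finite tree of local steps, with every branch ending
   on the systems B, realizes the map Phi from operators on A to operators on
   B.  In one step each party performs an operation of the given kind; a party
   is idle when its factor is the identity, a one-dimensional ancilla (which
   can be renamed away), or a one-outcome trivial measurement.  After a measurement the joint outcome is
   known to all parties, and the continuation depends on it; the transcript is
   forgotten at the end, hence the sum over branches.  All these maps are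
   completely positive and trace preserving by construction. *)
Inductive locc (B : 'I_m -> finType) :
    forall A : 'I_m -> finType, (gop A -> gop B) -> Prop :=
| locc_done : locc (fun X : gop B => X)
| locc_relabel (A A' : 'I_m -> finType) (f : forall i, A' i -> A i)
    (Phi : gop A' -> gop B) :
    (forall i, bijective (f i)) ->
    locc Phi -> locc (fun X : gop A => Phi (relabel f X))
| locc_state (A K : 'I_m -> finType) (rho : forall i, op R (K i))
    (Phi : gop (adjoin A K) -> gop B) :
    (forall i, density (rho i)) ->
    locc Phi -> locc (fun X : gop A => Phi (introduce (tens rho) X))
| locc_unitary (A : 'I_m -> finType) (u : forall i, op R (A i))
    (Phi : gop A -> gop B) :
    (forall i, u i \is unitarymx) ->
    locc Phi -> locc (fun X : gop A => Phi (conjop (tens u) X))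
| locc_measure (A O : 'I_m -> finType) (M : forall i, O i -> op R (A i))
    (Phi : glob O -> gop A -> gop B) :
    (forall i, kraus_complete (M i)) ->
    (forall k, locc (Phi k)) ->
    locc (fun X : gop A =>
            \sum_(k : glob O) Phi k (conjop (tens (fun i => M i (k i))) X))
| locc_discard (A K : 'I_m -> finType) (Phi : gop A -> gop B) :
    locc Phi -> locc (fun X : gop (adjoin A K) => Phi (discard X)).

Section Symmetry.
Variable gT : 'I_m -> finGroupType.

Definition systems := forall i, prep R (gT i).

Definition basis (A : systems) : 'I_m -> finType := fun i => carrier (A i).

Definition sadjoin (A K : systems) : systems := fun i => tens_prep (A i) (K i).

Definition grep (A : systems) (g : {dffun forall i, gT i}) : gop (basis A) :=
  tens (fun i => rep (A i) (g i)).

Variable H : {group {dffun forall i, gT i}}.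

Definition covariant (A B : systems) (Phi : gop (basis A) -> gop (basis B)) :
    Prop :=
  forall g, g \in H -> forall L,
    Phi (conjop (grep A g) L) = conjop (grep B g) (Phi L).

Definition covLOCC (A B : systems) (Phi : gop (basis A) -> gop (basis B)) :
    Prop :=
  locc Phi /\ covariant Phi.

Definition invariant_op (i : 'I_m) (A : prep R (gT i)) (X : op R A) : Prop :=
  forall g, g \in H -> rep A (g i) *m X = X *m rep A (g i).

(* The primitive-level theory.  Same tree structure as [locc], with steps
   restricted by the symmetry; [free K sigma] says that the shared state sigma
   on the systems K may be introduced as an additional step.  The
   transcript carries no representation and quantum systems never change party.
   For a state, [invariant_op] amounts to U rho U^* = rho as U is unitary. *)
Inductive prim (free : forall K : systems, gop (basis K) -> Prop)
    (B : systems) :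
    forall A : systems, (gop (basis A) -> gop (basis B)) -> Prop :=
| prim_done : prim free (fun X : gop (basis B) => X)
| prim_relabel (A A' : systems) (f : forall i, A' i -> A i)
    (Phi : gop (basis A') -> gop (basis B)) :
    (forall i, bijective (f i)) ->
    (forall i g x y, ent (rep (A' i) g) x y = ent (rep (A i) g) (f i x) (f i y)) ->
    prim free Phi ->
    prim free (fun X : gop (basis A) =>
      Phi (@relabel (basis A) (basis A') f X))
| prim_state (A K : systems) (rho : forall i, op R (K i))
    (Phi : gop (basis (sadjoin A K)) -> gop (basis B)) :
    (forall i, density (rho i)) ->
    (forall i, invariant_op (rho i)) ->
    prim free Phi ->
    prim free (fun X : gop (basis A) =>
      Phi (@introduce (basis A) (basis K) (@tens (basis K) rho) X))
| prim_unitary (A : systems) (u : forall i, op R (A i))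
    (Phi : gop (basis A) -> gop (basis B)) :
    (forall i, u i \is unitarymx) ->
    (forall i, invariant_op (u i)) ->
    prim free Phi ->
    prim free (fun X : gop (basis A) => Phi (conjop (@tens (basis A) u) X))
| prim_measure (A : systems) (O : 'I_m -> finType)
    (P : forall i, O i -> op R (A i))
    (Phi : glob O -> gop (basis A) -> gop (basis B)) :
    (forall i, projective_measurement (P i)) ->
    (forall i k, invariant_op (P i k)) ->
    (forall k, prim free (Phi k)) ->
    prim free (fun X : gop (basis A) =>
      \sum_(k : glob O)
        Phi k (conjop (@tens (basis A) (fun i => P i (k i))) X))
| prim_discard (A K : systems) (Phi : gop (basis A) -> gop (basis B)) :
    prim free Phi ->
    prim free (fun X : gop (basis (sadjoin A K)) =>
      Phi (@discard (basis A) (basis K) X))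
| prim_free (A K : systems) (sigma : gop (basis K))
    (Phi : gop (basis (sadjoin A K)) -> gop (basis B)) :
    free K sigma ->
    prim free Phi ->
    prim free (fun X : gop (basis A) =>
      Phi (@introduce (basis A) (basis K) sigma X)).

Definition registers : systems := fun i => reg_prep R (gT i).

Definition ketbra (T : finType) (x : T) : op R T :=
  delta_mx (enum_rank x) (enum_rank x).

Definition Gamma : gop (basis registers) :=
  (#|H|%:R)^-1 *:
    \sum_(g in H) @tens (basis registers) (fun i => ketbra (g i)).

Variant free_Gamma : forall K : systems, gop (basis K) -> Prop :=
  FreeGamma : free_Gamma Gamma.

End Symmetry.
End Multipartite.

(* Main.v *)
Require Import Defs.
From mathcomp Require Import all_boot all_order all_algebra all_fingroup.
From mathcomp Require Import all_solvable boolp ring.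
Set Implicit Arguments.
Unset Strict Implicit.
Unset Printing Implicit Defensive.
Import Order.TTheory GRing.Theory Num.Theory.
Local Open Scope ring_scope.
Local Open Scope sesquilinear_scope.

(* The state Gamma_H hands every party its component of a common random g in H,
   covariantly, so it can serve as a reference frame.  Controlled on g, the
   parties swap their systems with ancillas on which the symmetry acts
   trivially, in such a way that a state X arrives as U(g)^* X U(g).  On the
   ancillas every operation is symmetric, so the given LOCC protocol runs
   unchanged, except that its measurements are first dilated to projective ones.
   A second controlled swap brings the result back as
   U'(g) E(U(g)^* X U(g)) U'(g)^*, which is E(X) by covariance, whatever g is.
   Conversely each primitive step is LOCC and covariant, Gamma_H being invariant
   and preparable from shared randomness.  *)

(** * Operators on product bases *)

(** A party cannot just rotate its own system by U(g)^* controlled on the register: in general that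
    operator does not commute with the symmetry, but intertwines, up to a phase depending on g, the
    given representation with the trivial one. Swapping with an ancilla of trivial representation
    turns this change of representation into a unitary on a fixed system, and the phases cancel in
    the process, so projective multipliers do no harm. The ancilla that receives the output carries
    U' and must start in an invariant state; a projective representation may have no invariant pure
    state, whence the maximally mixed one. The final rotation depends on g, so the register has to
    survive the whole protocol: every simulated step therefore acts beside spectator systems that
    may transform nontrivially. *)

Lemma sum_prod (V : nmodType) (S T : finType) (F : S * T -> V) :
  \sum_z F z = \sum_x \sum_y F (x, y).
Proof. by rewrite pair_bigA; apply: eq_bigr => -[]. Qed.

Section OperatorCalculus.
Variable R : realType.

Lemma ent0 (T : finType) x y : ent (0 : op R T) x y = 0.
Proof. by rewrite /ent mxE. Qed.

Lemma entD (T : finType) (X Y : op R T) x y :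
  ent (X + Y) x y = ent X x y + ent Y x y.
Proof. by rewrite /ent mxE. Qed.

Lemma entB (T : finType) (X Y : op R T) x y :
  ent (X - Y) x y = ent X x y - ent Y x y.
Proof. by rewrite /ent !mxE. Qed.

Lemma entN (T : finType) (X : op R T) x y : ent (- X) x y = - ent X x y.
Proof. by rewrite /ent mxE. Qed.

Lemma ent_sum (T I : finType) (P : pred I) (F : I -> op R T) x y :
  ent (\sum_(i | P i) F i) x y = \sum_(i | P i) ent (F i) x y.
Proof. by rewrite /ent summxE. Qed.

Lemma ent_trace (T : finType) (X : op R T) : \tr X = \sum_x ent X x x.
Proof.
rewrite /mxtrace (reindex (@enum_rank T)) //=.
by exists enum_val => ? _; rewrite ?enum_rankK ?enum_valK.
Qed.

Lemma ent_ketbra (T : finType) (t x y : T) :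
  ent (ketbra R t) x y = ((x == t) && (y == t))%:R.
Proof. by rewrite /ent mxE !(inj_eq enum_rank_inj). Qed.

Lemma ent_conjop (T : finType) (K X : op R T) x y :
  ent (conjop K X) x y = \sum_z \sum_w ent K x z * ent X z w * (ent K y w)^*.
Proof.
rewrite /conjop entM exchange_big /=; apply: eq_bigr => w _.
by rewrite entM ent_adj mulr_suml.
Qed.

Lemma dagM (T : finType) (X Y : op R T) : (X *m Y) ^t* = Y ^t* *m X ^t*.
Proof. by rewrite trmx_mul map_mxM. Qed.

Lemma dagK (T : finType) (X : op R T) : (X ^t*) ^t* = X.
Proof. by apply: opP => x y; rewrite !ent_adj conjCK. Qed.

Lemma dag1 (T : finType) : (1%:M : op R T) ^t* = 1%:M.
Proof. by rewrite trmx1 map_mx1. Qed.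

Lemma dagB (T : finType) (X Y : op R T) : (X - Y) ^t* = X ^t* - Y ^t*.
Proof. by apply: opP => x y; rewrite ent_adj !entB !ent_adj rmorphB. Qed.

Lemma dagN (T : finType) (X : op R T) : (- X) ^t* = - X ^t*.
Proof. by apply: opP => x y; rewrite ent_adj !entN ent_adj rmorphN. Qed.

Lemma dagZ (T : finType) c (X : op R T) : (c *: X) ^t* = c^* *: X ^t*.
Proof. by apply: opP => x y; rewrite ent_adj !entZ !ent_adj rmorphM. Qed.

Lemma conjop_comp (T : finType) (K L X : op R T) :
  conjop K (conjop L X) = conjop (K *m L) X.
Proof. by rewrite /conjop dagM !mulmxA. Qed.

Lemma conjopZl (T : finType) c (K X : op R T) :
  conjop (c *: K) X = (`|c| ^+ 2) *: conjop K X.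
Proof.
by rewrite /conjop dagZ -!scalemxAl -scalemxAr scalerA normCK.
Qed.

Lemma conjopZr (T : finType) c (K X : op R T) :
  conjop K (c *: X) = c *: conjop K X.
Proof. by rewrite /conjop -scalemxAr -scalemxAl. Qed.

Lemma conjop_linear (T : finType) (K : op R T) c X Y :
  conjop K (c *: X + Y) = c *: conjop K X + conjop K Y.
Proof. by rewrite /conjop mulmxDr mulmxDl -scalemxAr -scalemxAl. Qed.

Lemma unitary_adjl (T : finType) (U : op R T) :
  U \is unitarymx -> U ^t* *m U = 1%:M.
Proof. by move/unitarymxP/mulmx1C. Qed.

Lemma conjop_unitaryK (T : finType) (U X : op R T) :
  U \is unitarymx -> conjop U (conjop (U ^t*) X) = X.
Proof.
by move=> /unitarymxP uU; rewrite conjop_comp uU /conjop mul1mx dag1 mulmx1.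
Qed.

Lemma conjop_trace (T : finType) (U X : op R T) :
  U \is unitarymx -> \tr (conjop U X) = \tr X.
Proof.
by move=> uU; rewrite /conjop mxtrace_mulC mulmxA unitary_adjl ?mul1mx.
Qed.

Lemma dag_unitary (T : finType) (U : op R T) :
  U \is unitarymx -> U ^t* \is unitarymx.
Proof. by move=> uU; apply/unitarymxP; rewrite dagK unitary_adjl. Qed.

Lemma density_ketbra (T : finType) (t : T) : density (ketbra R t).
Proof.
split; last first.
  rewrite ent_trace (bigD1 t) //= ent_ketbra eqxx big1 ?addr0 // => x /negPf nx.
  by rewrite ent_ketbra nx.
move=> v; rewrite !mxE (bigD1 (enum_rank t)) //= big1 ?addr0.
  rewrite !mxE (bigD1 (enum_rank t)) //= big1 ?addr0.
    by rewrite !mxE !eqxx mulr1 mulrC -normCK exprn_ge0.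
  by move=> j /negPf nj; rewrite !mxE nj mulr0.
move=> j /negPf nj; rewrite !mxE big1 ?mul0r // => k _.
by rewrite !mxE nj andbF mulr0.
Qed.

Definition mixed (T : finType) : op R T := (#|T|%:R)^-1 *: 1%:M.

Lemma density_mixed (T : finType) : (0 < #|T|)%N -> density (mixed T).
Proof.
move=> T0; split; last first.
  by rewrite mxtraceZ mxtrace1 mulVf // pnatr_eq0 -lt0n.
move=> v; rewrite /mixed -scalemxAr mulmx1 -scalemxAl mxE.
apply: mulr_ge0; first by rewrite invr_ge0 ler0n.
by rewrite mxE sumr_ge0 // => j _; rewrite !mxE mulrC -normCK exprn_ge0.
Qed.

Lemma density_card (T : finType) (rho : op R T) : density rho -> (0 < #|T|)%N.
Proof.
case=> _; rewrite ent_trace => tr1; rewrite lt0n; apply/eqP => T0.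
move: tr1; rewrite big1 => [/esym/eqP|x _]; first by rewrite oner_eq0.
by have := card0_eq T0 x; rewrite inE.
Qed.

End OperatorCalculus.

Section ProductBasis.
Variables (R : realType) (m : nat).
Implicit Types A B K S O : 'I_m -> finType.

Lemma glob_distr A (F : forall i, A i -> R[i]) :
  \sum_(z : glob A) \prod_i F i (z i) = \prod_i \sum_(a : A i) F i a.
Proof.
pose P i : {ffun A i -> R[i]} := [ffun a => F i a].
rewrite (reindex (@dffun_of_fprod _ A)); last exact/onW_bij/dffun_of_fprod_bij.
transitivity (\sum_(t : fprod A) \prod_i P i (t i)).
  by apply: eq_bigr => t _; apply: eq_bigr => i _; rewrite !ffunE.
rewrite (big_fprod 1 _ P); transitivity (\prod_i \sum_(a : A i) P i a); last first.
  by apply: eq_bigr => i _; apply: eq_bigr => a _; rewrite ffunE.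
(* Distributivity is applied over one common index type, the disjoint union of the [A i], to which
   [untag] extends each factor by 0. *)
rewrite -(bigA_distr_big_dep _ (fun i j => untag 0 (P i) j)).
by apply: eq_bigr => i _; exact/esym/(big_tag (fun i => P i : A i -> R[i]) i).
Qed.

Lemma glob_eq A (x y : glob A) : (x == y)%:R = \prod_i (x i == y i)%:R :> R[i].
Proof.
have [->|nxy] := eqVneq x y; first by rewrite big1 // => i _; rewrite eqxx.
have [i nxyi] : exists i, x i != y i.
  apply/existsP; apply: contraNT nxy => /existsPn exy.
  by apply/eqP/ffunP => i; apply/eqP; rewrite -[_ == _]negbK.
by rewrite (bigD1 i) //= (negPf nxyi) mul0r.
Qed.

Lemma gpair_fst A K (x : glob A) (k : glob K) : gfst (gpair x k) = x.
Proof. by apply/ffunP => i; rewrite !ffunE. Qed.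

Lemma gpair_snd A K (x : glob A) (k : glob K) : gsnd (gpair x k) = k.
Proof. by apply/ffunP => i; rewrite !ffunE. Qed.

Lemma gpair_eta A K (z : glob (adjoin A K)) : gpair (gfst z) (gsnd z) = z.
Proof. by apply/ffunP => i; rewrite !ffunE -surjective_pairing. Qed.

Lemma glob_pair_sum (V : nmodType) A K (F : glob (adjoin A K) -> V) :
  \sum_z F z = \sum_x \sum_k F (gpair x k).
Proof.
rewrite pair_bigA (reindex (fun p : glob A * glob K => gpair p.1 p.2)) //=.
exists (fun z => (gfst z, gsnd z)) => [[x k]|z] _ /=.
  by rewrite gpair_fst gpair_snd.
by rewrite gpair_eta.
Qed.

Lemma gopP A K (X Y : gop R (adjoin A K)) :
  (forall x k y l, ent X (gpair x k) (gpair y l) = ent Y (gpair x k) (gpair y l))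
  -> X = Y.
Proof.
by move=> e; apply: opP => z w; rewrite -(gpair_eta z) -(gpair_eta w).
Qed.

Lemma ent_tens A (u : forall i, op R (A i)) x y :
  ent (tens u) x y = \prod_i ent (u i) (x i) (y i).
Proof. exact: mkopE. Qed.

Lemma tensM A (u v : forall i, op R (A i)) :
  tens u *m tens v = tens (fun i => u i *m v i).
Proof.
apply: opP => x y; rewrite entM.
under eq_bigr do rewrite !ent_tens -big_split /=.
rewrite (glob_distr (fun i a => ent (u i) (x i) a * ent (v i) a (y i))) ent_tens.
by apply: eq_bigr => i _; rewrite entM.
Qed.

Lemma tens_adj A (u : forall i, op R (A i)) :
  (tens u) ^t* = tens (fun i => (u i) ^t*).
Proof.
apply: opP => x y; rewrite ent_adj !ent_tens rmorph_prod.
by apply: eq_bigr => i _; rewrite ent_adj.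
Qed.

Lemma tens1 A : tens (fun i => 1%:M : op R (A i)) = 1%:M.
Proof.
apply: opP => x y; rewrite ent_tens ent1 glob_eq.
by apply: eq_bigr => i _; rewrite ent1.
Qed.

Lemma eq_tens A (u v : forall i, op R (A i)) :
  (forall i, u i = v i) -> tens u = tens v.
Proof.
by move=> e; apply: opP => x y; rewrite !ent_tens; apply: eq_bigr => i _; rewrite e.
Qed.

Lemma tens_unitary A (u : forall i, op R (A i)) :
  (forall i, u i \is unitarymx) -> tens u \is unitarymx.
Proof.
move=> uu; apply/unitarymxP; rewrite tens_adj tensM -tens1.
by apply: eq_tens => i; rewrite (unitarymxP (uu i)).
Qed.

Lemma tens_trace A (u : forall i, op R (A i)) : \tr (tens u) = \prod_i \tr (u i).
Proof.
rewrite ent_trace (eq_bigr _ (fun z _ => ent_tens u z z)).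
rewrite (glob_distr (fun i a => ent (u i) a a)).
by apply: eq_bigr => i _; rewrite ent_trace.
Qed.

Lemma tensZ A (c : 'I_m -> R[i]) (u : forall i, op R (A i)) :
  tens (fun i => c i *: u i) = (\prod_i c i) *: tens u.
Proof.
apply: opP => x y; rewrite entZ !ent_tens -big_split /=.
by apply: eq_bigr => i _; rewrite entZ.
Qed.

Lemma ent_tens_ketbra A (t x y : glob A) :
  ent (tens (fun i => ketbra R (t i))) x y = ((x == t) && (y == t))%:R.
Proof.
rewrite ent_tens -mulnb natrM !glob_eq -big_split /=.
by apply: eq_bigr => i _; rewrite ent_ketbra -mulnb natrM.
Qed.

Lemma ent_tens_tensop A K (u : forall i, op R (A i)) (v : forall i, op R (K i))
    x k y l :
  ent (tens (A := adjoin A K) (fun i => tensop (u i) (v i)))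
    (gpair x k) (gpair y l) = ent (tens u) x y * ent (tens v) k l.
Proof.
rewrite !ent_tens -big_split /=; apply: eq_bigr => i _.
by rewrite !ffunE mkopE.
Qed.

Lemma ent_introduce A K (sigma : gop R K) (X : gop R A) x k y l :
  ent (introduce sigma X) (gpair x k) (gpair y l) = ent X x y * ent sigma k l.
Proof. by rewrite mkopE !gpair_fst !gpair_snd. Qed.

Lemma ent_discard A K (X : gop R (adjoin A K)) x y :
  ent (discard X) x y = \sum_k ent X (gpair x k) (gpair y k).
Proof. exact: mkopE. Qed.

Definition grelabel A A' (f : forall i, A' i -> A i) (x : glob A') : glob A :=
  finfun (fun i => f i (x i) : A i).

Lemma ent_relabel A A' (f : forall i, A' i -> A i) (X : gop R A) x y :
  ent (relabel f X) x y = ent X (grelabel f x) (grelabel f y).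
Proof. exact: mkopE. Qed.

Lemma grelabel_bij A A' (f : forall i, A' i -> A i) :
  (forall i, bijective (f i)) -> bijective (grelabel f).
Proof.
move=> bf.
have inv i : {g : A i -> A' i | cancel (f i) g /\ cancel g (f i)}.
  by apply: cid; case: (bf i) => g fK gK; exists g.
exists (grelabel (fun i => sval (inv i))) => x; apply/ffunP => i; rewrite !ffunE.
  by case: (inv i) => g /= [].
by case: (inv i) => g /= [].
Qed.

Lemma relabel_linear A A' (f : forall i, A' i -> A i) c (X Y : gop R A) :
  relabel f (c *: X + Y) = c *: relabel f X + relabel f Y.
Proof. by apply: opP => x y; rewrite !(entD, entZ, ent_relabel). Qed.

Lemma introduce_linear A K (sigma : gop R K) c (X Y : gop R A) :
  introduce sigma (c *: X + Y) = c *: introduce sigma X + introduce sigma Y.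
Proof.
by apply: gopP => x k y l; rewrite !(entD, entZ, ent_introduce) mulrDl mulrA.
Qed.

Lemma introduce_suml A K (I : finType) (P : pred I) (s : I -> gop R K)
    (X : gop R A) :
  introduce (\sum_(i | P i) s i) X = \sum_(i | P i) introduce (s i) X.
Proof.
apply: gopP => x k y l; rewrite ent_introduce !ent_sum mulr_sumr.
by apply: eq_bigr => i _; rewrite ent_introduce.
Qed.

Lemma introduceZl A K c (s : gop R K) (X : gop R A) :
  introduce (c *: s) X = c *: introduce s X.
Proof.
by apply: gopP => x k y l; rewrite entZ !ent_introduce entZ mulrCA.
Qed.

Lemma discard_linear A K c (X Y : gop R (adjoin A K)) :
  discard (c *: X + Y) = c *: discard X + discard Y.
Proof.
apply: opP => x y; rewrite !(entD, entZ, ent_discard) mulr_sumr -big_split /=.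
by apply: eq_bigr => k _; rewrite entD entZ.
Qed.

End ProductBasis.

(** * Linearity of LOCC maps and covariance of primitive ones *)

Section LoccMaps.
Variables (R : realType) (m : nat).
Implicit Types A B K S O : 'I_m -> finType.

(** The map is an index of the inductive family, so rewriting it pointwise takes function
    extensionality. *)
Lemma locc_ext A B (F G : gop R A -> gop R B) : locc F -> F =1 G -> locc G.
Proof. by move=> lF /funext <-. Qed.

Lemma locc_linear A B (Phi : gop R A -> gop R B) :
  locc Phi -> forall c X Y, Phi (c *: X + Y) = c *: Phi X + Phi Y.
Proof.
elim=> {A Phi} //.
- by move=> A A' f Phi _ _ IH c X Y; rewrite relabel_linear IH.
- by move=> A K rho Phi _ _ IH c X Y; rewrite introduce_linear IH.
- by move=> A u Phi _ _ IH c X Y; rewrite conjop_linear IH.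
- move=> A O M Phi _ _ IH c X Y; rewrite scaler_sumr -big_split /=.
  by apply: eq_bigr => k _; rewrite conjop_linear IH.
- by move=> A K Phi _ IH c X Y; rewrite discard_linear IH.
Qed.

Lemma locc0 A B (Phi : gop R A -> gop R B) : locc Phi -> Phi 0 = 0.
Proof.
move/locc_linear/(_ (-1) 0 0); rewrite scaler0 addr0 scaleN1r addrC => {1}->.
exact: subrr.
Qed.

Lemma loccZ A B (Phi : gop R A -> gop R B) c X :
  locc Phi -> Phi (c *: X) = c *: Phi X.
Proof.
by move=> lPhi; have := locc_linear lPhi c X 0; rewrite (locc0 lPhi) !addr0.
Qed.

Lemma locc_sum A B (Phi : gop R A -> gop R B) (I : finType) (P : pred I) F :
  locc Phi -> Phi (\sum_(i | P i) F i) = \sum_(i | P i) Phi (F i).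
Proof.
move=> lPhi; apply: (big_morph Phi) => [X Y|]; last exact: locc0.
by have := locc_linear lPhi 1 X Y; rewrite !scale1r.
Qed.

(** An empty sum is 0, which is the identity only on a zero-dimensional space. The dilation needs an
    outcome to label the initial state of its ancilla. *)
Lemma kraus_outcome (T O : finType) (M : O -> op R T) :
  kraus_complete M -> (0 < #|T|)%N -> (0 < #|O|)%N.
Proof.
move=> cM /card_gt0P[x _]; rewrite lt0n; apply/eqP => O0.
have : ent (1%:M : op R T) x x = 0.
  rewrite -cM ent_sum big1 // => k _.
  by have := card0_eq O0 k; rewrite inE.
by rewrite ent1 eqxx => /eqP; rewrite oner_eq0.
Qed.

Lemma kraus_glob A O (M : forall i, O i -> op R (A i)) :
  (forall i, kraus_complete (M i)) -> (forall i, (0 < #|A i|)%N) ->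
  inhabited (glob O).
Proof.
move=> cM A0; have pt i : {k : O i | true}.
  by apply: cid; have /card_gt0P[k _] := kraus_outcome (cM i) (A0 i); exists k.
by constructor; exact: (finfun (fun i => sval (pt i))).
Qed.

(** Unit trace rules out empty ancillas and completeness rules out empty outcome sets, so no step
    can empty a system. This makes [mixed] a state on the output systems as well. *)
Lemma locc_nonempty A B (Phi : gop R A -> gop R B) :
  locc Phi -> (forall i, (0 < #|A i|)%N) -> forall i, (0 < #|B i|)%N.
Proof.
elim=> {A Phi} //.
- move=> A A' f Phi bf _ IH A0; apply: IH => i.
  by rewrite (bij_eq_card (bf i)).
- move=> A K rho Phi drho _ IH A0; apply: IH => i.
  by rewrite /adjoin card_prod muln_gt0 A0 (density_card (drho i)).
- by move=> A O M Phi cM _ IH A0; case: (kraus_glob cM A0) => k; exact: IH k A0.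
- move=> A K Phi _ IH AK0; apply: IH => i.
  by have := AK0 i; rewrite /adjoin card_prod muln_gt0 => /andP[].
Qed.

End LoccMaps.

Section PrimIsCovariantLocc.
Variables (R : realType) (m : nat) (gT : 'I_m -> finGroupType).
Variable H : {group {dffun forall i, gT i}}.
Implicit Types A B K : systems R gT.

Lemma projective_kraus (T O : finType) (P : O -> op R T) :
  projective_measurement P -> kraus_complete P.
Proof.
by case=> hP iP sP; rewrite /kraus_complete -[RHS]sP; apply: eq_bigr => k _;
  rewrite hP iP.
Qed.

Lemma grep_unitary A g : grep A g \is unitarymx.
Proof. by apply: tens_unitary => i; exact: rep_unitary. Qed.

Lemma grep_sadjoin A K g :
  grep (sadjoin A K) g = tens (A := adjoin (basis A) (basis K))
    (fun i => tensop (rep (A i) (g i)) (rep (K i) (g i))).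
Proof. by []. Qed.

Lemma covariant_relabel A A' (f : forall i, A' i -> A i) g
    (X : gop R (basis A)) :
  (forall i, bijective (f i)) ->
  (forall i g x y, ent (rep (A' i) g) x y = ent (rep (A i) g) (f i x) (f i y)) ->
  @relabel _ _ (basis A) (basis A') f (conjop (grep A g) X) =
  conjop (grep A' g) (@relabel _ _ (basis A) (basis A') f X).
Proof.
move=> bf cf; have eg x y : ent (grep A' g) x y =
    ent (grep A g) (@grelabel _ (basis A) (basis A') f x)
      (@grelabel _ (basis A) (basis A') f y).
  by rewrite !ent_tens; apply: eq_bigr => i _; rewrite cf !ffunE.
have bF := @grelabel_bij _ (basis A) (basis A') f bf.
apply: opP => x y; rewrite ent_relabel !ent_conjop (reindex _ (onW_bij _ bF)).
apply: eq_bigr => z _; rewrite (reindex _ (onW_bij _ bF)); apply: eq_bigr => w _.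
by rewrite -!eg ent_relabel.
Qed.

Lemma covariant_introduce A K g (sigma : gop R (basis K)) (X : gop R (basis A)) :
  introduce (conjop (grep K g) sigma) (conjop (grep A g) X) =
  conjop (grep (sadjoin A K) g) (introduce sigma X).
Proof.
apply: gopP => x k y l; rewrite ent_introduce !ent_conjop grep_sadjoin.
rewrite glob_pair_sum big_distrlr /=.
rewrite exchange_big /= [RHS]exchange_big /=; apply: eq_bigr => k' _.
apply: eq_bigr => x' _.
rewrite glob_pair_sum big_distrlr /=; apply: eq_bigr => y' _.
apply: eq_bigr => l' _.
rewrite ent_introduce !ent_tens_tensop rmorphM /grep.
ring.
Qed.

(** The partial trace absorbs the unitary acting on the discarded factor: summing over its basis
    leaves U^* U = 1 there. *)
Lemma covariant_discard A K g (X : gop R (basis (sadjoin A K))) :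
  discard (conjop (grep (sadjoin A K) g) X) =
  conjop (grep A g) (@discard _ _ (basis A) (basis K) X).
Proof.
apply: opP => x y; rewrite ent_discard ent_conjop.
transitivity (\sum_k \sum_x' \sum_k' \sum_y' \sum_l'
   (ent (grep A g) x x' * ent X (gpair x' k') (gpair y' l') *
     (ent (grep A g) y y')^*) * (ent (grep K g) k k' * (ent (grep K g) k l')^*)).
  apply: eq_bigr => k _; rewrite ent_conjop grep_sadjoin glob_pair_sum.
  apply: eq_bigr => x' _; apply: eq_bigr => k' _.
  rewrite glob_pair_sum; apply: eq_bigr => y' _; apply: eq_bigr => l' _.
  by rewrite !ent_tens_tensop rmorphM /grep; ring.
rewrite exchange_big /=; apply: eq_bigr => x' _.
have uK k' l' : \sum_k ent (grep K g) k k' * (ent (grep K g) k l')^* =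
    (l' == k')%:R.
  rewrite -ent1 -(unitary_adjl (grep_unitary K g)) entM.
  by apply: eq_bigr => k _; rewrite ent_adj mulrC.
transitivity (\sum_k' \sum_y' \sum_l'
   (ent (grep A g) x x' * ent X (gpair x' k') (gpair y' l') *
     (ent (grep A g) y y')^*) * (l' == k')%:R).
  rewrite exchange_big /=; apply: eq_bigr => k' _.
  rewrite exchange_big /=; apply: eq_bigr => y' _.
  rewrite exchange_big /=; apply: eq_bigr => l' _.
  by rewrite -mulr_sumr uK.
rewrite exchange_big /=; apply: eq_bigr => y' _.
rewrite ent_discard mulr_sumr mulr_suml; apply: eq_bigr => k' _.
rewrite (bigD1 k') //= eqxx mulr1 big1 ?addr0 // => l' /negPf ->.
by rewrite mulr0.
Qed.

Lemma covariant_conjop A (u : forall i, op R (A i)) g (X : gop R (basis A)) :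
  g \in H -> (forall i, invariant_op H (u i)) ->
  @conjop _ _ (@tens _ _ (basis A) u) (conjop (grep A g) X) =
  conjop (grep A g) (@conjop _ _ (@tens _ _ (basis A) u) X).
Proof.
move=> Hg iu; rewrite !conjop_comp /grep !tensM; congr (conjop _ X).
by apply: eq_tens => i; rewrite iu.
Qed.

Lemma invariant_tens K (rho : forall i, op R (K i)) g :
  g \in H -> (forall i, invariant_op H (rho i)) ->
  conjop (grep K g) (@tens _ _ (basis K) rho) = @tens _ _ (basis K) rho.
Proof.
move=> Hg irho; rewrite /conjop.
have -> : grep K g *m @tens _ _ (basis K) rho
        = @tens _ _ (basis K) rho *m grep K g.
  by rewrite /grep !tensM; apply: eq_tens => i; exact: irho.
by rewrite -mulmxA (unitarymxP (grep_unitary K g)) mulmx1.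
Qed.

Lemma conjop_ketbra_reg (G : finGroupType) (g h : G) :
  conjop (reg_rep R g) (ketbra R h) = ketbra R (g * h)%g.
Proof.
apply: opP => x y; rewrite ent_conjop (bigD1 h) //= (bigD1 h) //=.
rewrite !ent_ketbra !mkopE !eqxx mulr1 rmorph_nat -natrM mulnb.
rewrite !big1 ?addr0 // => z /negPf nz; last by rewrite ent_ketbra nz andbF mulr0 mul0r.
by rewrite big1 // => w _; rewrite ent_ketbra nz mulr0 mul0r.
Qed.

(** Left translation by an element of [H] permutes the summands. *)
Lemma invariant_Gamma g :
  g \in H -> conjop (grep (registers R gT) g) (Gamma R H) = Gamma R H.
Proof.
move=> Hg; rewrite /conjop /Gamma -scalemxAr -scalemxAl; congr (_ *: _).
rewrite mulmx_sumr mulmx_suml.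
rewrite [RHS](reindex_inj (mulgI g)) /=.
apply: eq_big => [h|h _]; first by rewrite groupMl.
rewrite tens_adj /grep !tensM; apply: eq_tens => i.
by rewrite -[LHS]/(conjop (reg_rep R (g i)) (ketbra R (h i))) conjop_ketbra_reg ffunE.
Qed.

Lemma prim_covariant A B (E : gop R (basis A) -> gop R (basis B)) :
  prim H (free_Gamma H) E -> covariant H E.
Proof.
elim=> {A E} //.
- move=> A A' f Phi bf cf _ IH g Hg X.
  by rewrite covariant_relabel // IH.
- move=> A K rho Phi _ irho _ IH g Hg X.
  by rewrite -IH // -covariant_introduce invariant_tens.
- by move=> A u Phi _ iu _ IH g Hg X; rewrite covariant_conjop // IH.
- move=> A O P Phi _ iP _ IH g Hg X.
  rewrite /conjop mulmx_sumr mulmx_suml; apply: eq_bigr => k _.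
  by rewrite -/(conjop _ _) covariant_conjop // IH.
- by move=> A K Phi _ IH g Hg X; rewrite covariant_discard IH.
- move=> A K sigma Phi fK; case: K sigma / fK Phi => Phi _ IH g Hg X.
  by rewrite -IH // -covariant_introduce invariant_Gamma.
Qed.

End PrimIsCovariantLocc.

(** * Primitive maps are LOCC *)

Section PrimIsLocc.
Variables (R : realType) (m : nat) (gT : 'I_m -> finGroupType).
Variable H : {group {dffun forall i, gT i}}.
Implicit Types A B K : systems R gT.

Lemma introduce_Gamma (A : 'I_m -> finType) (X : gop R A) :
  introduce (Gamma R H) X = \sum_(g in H) (#|H|%:R)^-1 *:
    introduce (tens (A := basis (registers R gT)) (fun i => ketbra R (g i))) X.
Proof. by rewrite /Gamma introduceZl introduce_suml scaler_sumr. Qed.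

Lemma kraus_scalar (T O : finType) (c : O -> R[i]) :
  \sum_k `|c k| ^+ 2 = 1 -> kraus_complete (fun k => c k *: (1%:M : op R T)).
Proof.
move=> sc; transitivity ((\sum_k `|c k| ^+ 2) *: (1%:M : op R T)); last first.
  by rewrite sc scale1r.
rewrite scaler_suml /kraus_complete.
apply: eq_bigr => k _.
by rewrite dagZ dag1 -scalemxAl -scalemxAr mulmx1 scalerA mulrC normCK.
Qed.

(* One party draws g uniformly from H by a measurement with Kraus operators
   proportional to the identity, and announces it; the parties then prepare
   the product state labelled by g. *)
Lemma locc_Gamma (A B : 'I_m -> finType)
    (Phi : gop R (adjoin A (basis (registers R gT))) -> gop R B) :
  locc Phi -> locc (fun X : gop R A => Phi (introduce (Gamma R H) X)).
Proof.
move=> lPhi.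
have lg (g : {dffun forall i, gT i}) : locc (fun X : gop R A =>
    Phi (introduce (tens (A := basis (registers R gT))
      (fun i => ketbra R (g i))) X)).
  by apply: locc_state lPhi => i; exact: density_ketbra.
have H0 : (#|H|%:R : R[i]) != 0 by rewrite pnatr_eq0 -lt0n cardG_gt0.
have PhiG X : Phi (introduce (Gamma R H) X) = \sum_(g in H) (#|H|%:R)^-1 *:
    Phi (introduce (tens (A := basis (registers R gT))
      (fun i => ketbra R (g i))) X).
  rewrite introduce_Gamma (locc_sum _ _ lPhi).
  by apply: eq_bigr => g _; rewrite loccZ.
(* Without parties nobody can draw the group element, but then the product group is trivial. *)
case: (pickP 'I_m) => [i0 _|noi]; last first.
  have dff (g : {dffun forall i, gT i}) : g = 1%g.
    by apply/ffunP => i; have := noi i.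
  apply: locc_ext (lg 1%g) _ => X; rewrite PhiG (eq_bigr (fun=> (#|H|%:R)^-1 *:
    Phi (introduce (tens (A := basis (registers R gT))
      (fun i => ketbra R ((1%g : {dffun forall i, gT i}) i))) X))).
    by rewrite sumr_const -scaler_nat scalerA mulfV ?scale1r.
  by move=> g _; rewrite (dff g).
(* All parties get the whole product group as outcome type. Only [i0] draws from it; the others
   obtain the outcome 1 with certainty. *)
pose O (i : 'I_m) : finType := {dffun forall i, gT i}.
pose c i (k : O i) : R[i] := if i == i0 then
  (k \in H)%:R * sqrtC (#|H|%:R)^-1 else (k == 1%g)%:R.
have cE i k : `|c i k| ^+ 2 =
    if i == i0 then (k \in H)%:R * (#|H|%:R)^-1 else (k == 1%g)%:R.
  rewrite /c; case: ifP => _; last first.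
    by rewrite normr_nat -natrX; case: eqP.
  rewrite normrM exprMn normr_nat ger0_norm ?sqrtC_ge0 ?invr_ge0 ?ler0n //.
  by rewrite sqrtCK -natrX; case: (k \in H).
have cC i : kraus_complete (fun k => c i k *: (1%:M : op R (A i))).
  apply: kraus_scalar; under eq_bigr do rewrite cE.
  case: (i == i0); last first.
    by rewrite (bigD1 1%g) //= eqxx big1 ?addr0 // => k /negPf ->.
  rewrite -mulr_suml (_ : \sum_k _ = #|H|%:R) ?mulfV // -sum1_card natr_sum.
  by rewrite [RHS]big_mkcond; apply: eq_bigr => k _; case: (k \in H).
have lm := locc_measure (A := A) (O := O)
  (M := fun i k => c i k *: (1%:M : op R (A i))) cC
  (fun k : glob O => lg (k i0)).
apply: locc_ext lm _ => X.
pose w (k : glob O) : R[i] := \prod_i `|c i (k i)| ^+ 2.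
transitivity (\sum_(k : glob O) w k *: Phi (introduce
  (tens (A := basis (registers R gT)) (fun i => ketbra R (k i0 i))) X)).
  apply: eq_bigr => k _; rewrite tensZ tens1 conjopZl /conjop mul1mx dag1 mulmx1.
  rewrite -(loccZ _ _ (lg (k i0))); congr (Phi (introduce _ (_ *: X))).
  by rewrite normr_prod -prodrXl.
rewrite PhiG.
pose h (g : {dffun forall i, gT i}) : glob O :=
  finfun (fun i => (if i == i0 then g else 1%g) : O i).
(* Outside the image of [h] some party other than [i0] has an outcome different from 1, so the
   branch has weight 0. *)
rewrite (bigID [pred k : glob O | h (k i0) == k]) /= [X in _ + X]big1 ?addr0.
  rewrite (reindex_onto h (fun k => k i0)) /=; last first.
    by move=> k /eqP.
  rewrite [RHS]big_mkcond /=; apply: eq_big => [g|g _].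
    by rewrite !ffunE eqxx !eqxx.
  rewrite !ffunE eqxx /w (bigD1 i0) //= big1 => [|i /negPf ni].
    rewrite mulr1 cE !ffunE eqxx.
    by case: ifP => _; rewrite ?mul1r // mul0r scale0r.
  by rewrite cE !ffunE ni eqxx.
move=> k /eqP hk; suff [i ni nk] : exists2 i, i != i0 & k i != 1%g.
  by rewrite /w (bigD1 i) //= cE (negPf ni) (negPf nk) mul0r scale0r.
apply: contrapT => nex; apply: hk; apply/ffunP => i; rewrite ffunE.
case: eqVneq => [->//|ni]; apply/esym/eqP/negPn/negP => nk.
by apply: nex; exists i.
Qed.

Lemma prim_locc A B (E : gop R (basis A) -> gop R (basis B)) :
  prim H (free_Gamma H) E -> locc E.
Proof.
elim=> {A E}.
- exact: locc_done.
- by move=> A A' f Phi bf _ _ IH; exact: locc_relabel.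
- by move=> A K rho Phi drho _ _ IH; exact: locc_state.
- by move=> A u Phi uu _ _ IH; exact: locc_unitary.
- move=> A O P Phi pP _ _ IH; apply: (locc_measure (M := P)) => // i.
  exact: projective_kraus.
- by move=> A K Phi _ IH; exact: locc_discard.
- by move=> A K sigma Phi fK; case: K sigma / fK Phi => Phi _; exact: locc_Gamma.
Qed.

End PrimIsLocc.

(** * Systems with trivial representation *)

Section TrivialSystems.
Variables (R : realType) (gT : finGroupType) (T : finType).

Definition triv_rep (_ : gT) : op R T := 1%:M.

Lemma triv_rep_unitary g : triv_rep g \is unitarymx.
Proof. by apply/unitarymxP; rewrite dag1 mulmx1. Qed.

Lemma triv_rep_mul g h :
  exists2 c : R[i], `|c| = 1
    & triv_rep g *m triv_rep h = c *: triv_rep (g * h)%g.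
Proof. by exists 1; rewrite ?normr1 // scale1r mulmx1. Qed.

Definition triv_prep : prep R gT := Prep triv_rep_unitary triv_rep_mul.

End TrivialSystems.

(** * Ampliation of maps by spectator systems *)

Section Spectators.
Variables (R : realType) (m : nat).
Implicit Types A B C K S O : 'I_m -> finType.

Definition slice A S (Z : gop R (adjoin A S)) (s t : glob S) : gop R A :=
  mkop (fun x y => ent Z (gpair x s) (gpair y t)).

(* The map Phi (x) id_S; for linear Phi it is the usual ampliation. *)
Definition ext S A B (Phi : gop R A -> gop R B) (Z : gop R (adjoin A S)) :
    gop R (adjoin B S) :=
  mkop (fun z w => ent (Phi (slice Z (gsnd z) (gsnd w))) (gfst z) (gfst w)).

Lemma ent_slice A S (Z : gop R (adjoin A S)) s t x y :
  ent (slice Z s t) x y = ent Z (gpair x s) (gpair y t).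
Proof. exact: mkopE. Qed.

Lemma ent_ext S A B (Phi : gop R A -> gop R B) Z x s y t :
  ent (ext (S := S) Phi Z) (gpair x s) (gpair y t) = ent (Phi (slice Z s t)) x y.
Proof. by rewrite mkopE !gpair_fst !gpair_snd. Qed.

Lemma slice_ext S A B (Phi : gop R A -> gop R B) Z s t :
  slice (ext (S := S) Phi Z) s t = Phi (slice Z s t).
Proof. by apply: opP => x y; rewrite ent_slice ent_ext. Qed.

Lemma ext_id S A Z : ext (S := S) (fun X : gop R A => X) Z = Z.
Proof. by apply: gopP => x s y t; rewrite ent_ext ent_slice. Qed.

Lemma ext_comp S A B C (Phi : gop R A -> gop R B) (Psi : gop R B -> gop R C) Z :
  ext (S := S) (fun X => Psi (Phi X)) Z = ext Psi (ext Phi Z).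
Proof. by apply: gopP => x s y t; rewrite !ent_ext slice_ext. Qed.

Lemma ext_sum S A B (I : finType) (Phi : I -> gop R A -> gop R B) Z :
  ext (S := S) (fun X => \sum_k Phi k X) Z = \sum_k ext (Phi k) Z.
Proof.
apply: gopP => x s y t; rewrite ent_ext !ent_sum.
by apply: eq_bigr => k _; rewrite ent_ext.
Qed.

Lemma ext_conjop S A (u : forall i, op R (A i)) Z :
  ext (S := S) (conjop (tens u)) Z =
  conjop (tens (A := adjoin A S) (fun i => tensop (u i) 1%:M)) Z.
Proof.
apply: gopP => x s y t; rewrite ent_ext !ent_conjop.
rewrite glob_pair_sum; apply: eq_bigr => x' _.
rewrite (bigD1 s) //= [X in _ + X]big1 ?addr0 => [|s' /negPf ns]; last first.
  by rewrite big1 // => w _; rewrite ent_tens_tensop tens1 ent1 eq_sym ns mulr0 !mul0r.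
rewrite glob_pair_sum; apply: eq_bigr => y' _.
rewrite (bigD1 t) //= [X in _ + X]big1 ?addr0 => [|t' /negPf nt]; last first.
  by rewrite !ent_tens_tensop !tens1 !ent1 [t == _]eq_sym nt mulr0 rmorph0 mulr0.
by rewrite ent_slice !ent_tens_tensop !tens1 !ent1 !eqxx !mulr1.
Qed.

Lemma ext_relabel S A A' (f : forall i, A' i -> A i) Z :
  ext (S := S) (relabel f) Z =
  relabel (A := adjoin A S) (A' := adjoin A' S) (fun i z => (f i z.1, z.2)) Z.
Proof.
apply: gopP => x s y t; rewrite ent_ext !ent_relabel ent_slice.
by congr (ent Z _ _); apply/ffunP => i; rewrite !ffunE.
Qed.

Definition exchange (T U V : Type) (z : T * U * V) : T * V * U :=
  (z.1.1, z.2, z.1.2).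

Lemma exchange_bij (T U V : Type) : bijective (@exchange T U V).
Proof. by exists (@exchange T V U) => -[[]]. Qed.

Lemma grelabel_exchange A S K x s k :
  grelabel (A := adjoin (adjoin A S) K) (A' := adjoin (adjoin A K) S)
    (fun i => @exchange (A i) (K i) (S i)) (gpair (gpair x k) s) =
  gpair (gpair x s) k.
Proof. by apply/ffunP => i; rewrite !ffunE. Qed.

Lemma ext_introduce S A K (sigma : gop R K) Z :
  ext (S := S) (introduce (A := A) sigma) Z =
  relabel (A := adjoin (adjoin A S) K) (A' := adjoin (adjoin A K) S)
    (fun i => @exchange (A i) (K i) (S i)) (introduce sigma Z).
Proof.
apply: gopP => z s w t; rewrite -(gpair_eta z) -(gpair_eta w).
by rewrite ent_ext ent_relabel !grelabel_exchange !ent_introduce ent_slice.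
Qed.

Lemma ext_discard S A K Z :
  ext (S := S) (@discard R m A K) Z =
  discard (A := adjoin A S) (relabel (A := adjoin (adjoin A K) S)
    (fun i => @exchange (A i) (S i) (K i)) Z).
Proof.
apply: gopP => x s y t; rewrite ent_ext !ent_discard; apply: eq_bigr => k _.
by rewrite ent_relabel !grelabel_exchange ent_slice.
Qed.

End Spectators.

(** * Symmetric simulation of single steps on trivially transforming systems *)

Section Simulation.
Variables (R : realType) (m : nat) (gT : 'I_m -> finGroupType).
Variable H : {group {dffun forall i, gT i}}.
Implicit Types A B C K O : 'I_m -> finType.
Local Notation prim := (prim H (free_Gamma H)).

Definition triv A : systems R gT := fun i => triv_prep R (gT i) (A i).

Lemma prim_ext (A B : systems R gT) (F G : gop R (basis A) -> gop R (basis B)) :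
  prim F -> F =1 G -> prim G.
Proof. by move=> pF /funext <-. Qed.

Lemma triv_invariant A i (X : op R (triv A i)) : invariant_op H X.
Proof. by move=> g _; rewrite mul1mx mulmx1. Qed.

Lemma tensop1_invariant A (S : systems R gT) i (X : op R (A i)) :
  invariant_op H (A := sadjoin (triv A) S i) (tensop X 1%:M).
Proof. by move=> g _; rewrite !tensop_mul !mul1mx !mulmx1. Qed.

(* Phi acts on systems with trivial representations, next to spectator systems
   carrying an arbitrary representation. *)
Definition simulable A B (Phi : gop R A -> gop R B) : Prop :=
  forall (C S : systems R gT)
    (Psi : gop R (basis (sadjoin (triv B) S)) -> gop R (basis C)),
  prim Psi ->
  prim (A := sadjoin (triv A) S) (fun Z => Psi (ext (S := basis S) Phi Z)).

Lemma simulable_ext A B (F G : gop R A -> gop R B) :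
  simulable F -> F =1 G -> simulable G.
Proof. by move=> sF /funext <-. Qed.

Lemma simulable_id A : simulable (fun X : gop R A => X).
Proof.
move=> C S Psi pPsi; apply: prim_ext pPsi _ => Z.
by rewrite (ext_id (A := A)).
Qed.

(** The constructors of [prim] only prefix a step to a tree. As [simulable] quantifies over all
    continuations, composing maps amounts to nesting continuations, and no concatenation of trees
    has to be proved. *)
Lemma simulable_comp A B C (Phi : gop R A -> gop R B) (Psi : gop R B -> gop R C) :
  simulable Phi -> simulable Psi -> simulable (fun X => Psi (Phi X)).
Proof.
move=> sPhi sPsi D S Xi pXi; apply: prim_ext (sPhi _ _ _ (sPsi _ _ _ pXi)) _ => Z.
exact: (congr1 Xi (esym (ext_comp Phi Psi Z))).
Qed.

Lemma simulable_relabel A A' (f : forall i, A' i -> A i) :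
  (forall i, bijective (f i)) -> simulable (@relabel R m A A' f).
Proof.
move=> bf C S Psi pPsi.
apply: prim_ext (prim_relabel (A := sadjoin (triv A) S)
  (A' := sadjoin (triv A') S) (f := fun i z => (f i z.1, z.2)) _ _ pPsi) _.
- by move=> i; case: (bf i) => g fK gK; exists (fun z => (g z.1, z.2)) => -[x s] /=;
    rewrite ?fK ?gK.
- move=> i g [x s] [y t]; rewrite !mkopE /= !ent1.
  by rewrite (inj_eq (bij_inj (bf i))).
- by move=> Z; exact: (congr1 Psi (esym (ext_relabel f Z))).
Qed.

Lemma simulable_state A K (rho : forall i, op R (K i)) :
  (forall i, density (rho i)) -> simulable (introduce (A := A) (tens rho)).
Proof.
move=> drho C S Psi pPsi.
have pr := prim_relabel (A := sadjoin (sadjoin (triv A) S) (triv K))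
  (A' := sadjoin (triv (adjoin A K)) S)
  (f := fun i => @exchange (A i) (K i) (S i)) _ _ pPsi.
apply: prim_ext (prim_state (A := sadjoin (triv A) S) (K := triv K)
  drho _ (pr _ _)) _.
- by move=> i; exact: triv_invariant.
- by move=> i; exact: exchange_bij.
- move=> i g [[x k] s] [[y l] t]; rewrite !mkopE /= ?mkopE /= !ent1.
  by rewrite xpair_eqE -mulnb natrM mulrAC.
- by move=> Z; exact: (congr1 Psi (esym (ext_introduce (tens rho) Z))).
Qed.

Lemma simulable_unitary A (u : forall i, op R (A i)) :
  (forall i, u i \is unitarymx) -> simulable (conjop (tens u)).
Proof.
move=> uu C S Psi pPsi; apply: prim_ext (prim_unitary
  (A := sadjoin (triv A) S) (u := fun i => tensop (u i) 1%:M) _ _ pPsi) _.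
- move=> i; apply/unitarymxP; rewrite tensop_adj tensop_mul dag1 mulmx1.
  by rewrite (unitarymxP (uu i)) tensop1.
- by move=> i; exact: tensop1_invariant.
- by move=> Z; exact: (congr1 Psi (esym (ext_conjop u Z))).
Qed.

Lemma simulable_projective A O B (P : forall i, O i -> op R (A i))
    (Phi : glob O -> gop R A -> gop R B) :
  (forall i, projective_measurement (P i)) ->
  (forall k, simulable (Phi k)) ->
  simulable (fun X =>
    \sum_(k : glob O) Phi k (conjop (tens (fun i => P i (k i))) X)).
Proof.
(* The branches of the tree each end with their own copy of [Psi]; summing after it or before it
   agrees by linearity, which [Psi] has as a LOCC map. *)
move=> pP sPhi C S Psi pPsi; have lPsi := prim_locc pPsi.
apply: prim_ext (prim_measure (A := sadjoin (triv A) S)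
  (P := fun i k => tensop (P i k) 1%:M) _ _ (fun k => sPhi k C S Psi pPsi)) _.
- move=> i; case: (pP i) => hP iP sP; split.
  + by move=> k; rewrite tensop_adj hP dag1.
  + by move=> k; rewrite tensop_mul iP mulmx1.
  + apply: opP => -[x s] [y t]; rewrite ent_sum ent1.
    under eq_bigr do rewrite mkopE /=.
    by rewrite -mulr_suml -ent_sum sP !ent1 -natrM mulnb.
- by move=> i k; exact: tensop1_invariant.
- move=> Z; rewrite [X in _ = Psi X](ext_sum (fun k X =>
    Phi k (conjop (tens (fun i => P i (k i))) X))) (locc_sum _ _ lPsi).
  apply: eq_bigr => k _; congr Psi.
  rewrite [RHS](ext_comp (conjop (tens (fun i => P i (k i)))) (Phi k)).
  exact: (congr1 _ (esym (ext_conjop _ Z))).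
Qed.

Lemma simulable_discard A K : simulable (@discard R m A K).
Proof.
move=> C S Psi pPsi.
have pd := prim_discard (triv K) pPsi.
have pr := prim_relabel (A := sadjoin (triv (adjoin A K)) S)
  (A' := sadjoin (sadjoin (triv A) S) (triv K))
  (f := fun i => @exchange (A i) (S i) (K i)) _ _ pd.
apply: prim_ext (pr _ _) _.
- by move=> i; exact: exchange_bij.
- move=> i g [[x s] k] [[y t] l]; rewrite !mkopE /= ?mkopE /= !ent1.
  by rewrite xpair_eqE -mulnb natrM mulrAC.
- by move=> Z; exact: (congr1 Psi (esym (ext_discard Z))).
Qed.

End Simulation.

(** * Dilation of local measurements *)

Section Dilation.
Variables (R : realType) (T O : finType).

(** The bit is the block index, with [false] for the first row and column. It is paired with [O] so
    that both form a single ancilla next to [T]. *)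
Definition blockop (a b c d : op R (T * O)%type) : op R (T * (O * bool))%type :=
  mkop (fun x y =>
    ent (if x.2.2 then (if y.2.2 then d else c) else (if y.2.2 then b else a))
      (x.1, x.2.1) (y.1, y.2.1)).

Lemma blockop_mul a b c d a' b' c' d' :
  blockop a b c d *m blockop a' b' c' d' =
  blockop (a *m a' + b *m c') (a *m b' + b *m d')
          (c *m a' + d *m c') (c *m b' + d *m d').
Proof.
apply: opP => -[x [o i]] [y [p j]]; rewrite entM.
transitivity (\sum_(z : T * O)
   (ent (blockop a b c d) (x, (o, i)) (z.1, (z.2, true)) *
    ent (blockop a' b' c' d') (z.1, (z.2, true)) (y, (p, j)) +
    ent (blockop a b c d) (x, (o, i)) (z.1, (z.2, false)) *
    ent (blockop a' b' c' d') (z.1, (z.2, false)) (y, (p, j)))).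
  pose F (z : T * (O * bool)) := ent (blockop a b c d) (x, (o, i)) z *
    ent (blockop a' b' c' d') z (y, (p, j)).
  rewrite (reindex (fun q : T * O * bool => (q.1.1, (q.1.2, q.2)))) /=; last first.
    by exists (fun z => (z.1, z.2.1, z.2.2)) => [[[]]|[? []]].
  rewrite -(pair_bigA _ (fun q b => F (q.1, (q.2, b)))) /=.
  by apply: eq_bigr => z _; rewrite big_bool.
rewrite big_split /= !mkopE /=.
by case: i; case: j; rewrite entD !entM addrC; congr (_ + _);
   apply: eq_bigr => -[z q] _; rewrite !mkopE.
Qed.

Lemma blockop_adj a b c d :
  (blockop a b c d) ^t* = blockop (a ^t*) (c ^t*) (b ^t*) (d ^t*).
Proof.
apply: opP => -[x [o i]] [y [p j]]; rewrite ent_adj !mkopE /=.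
by case: i; case: j; rewrite ent_adj.
Qed.

Lemma blockop1 : blockop 1%:M 0 0 1%:M = 1%:M.
Proof.
apply: opP => -[x [o i]] [y [p j]]; rewrite mkopE ent1 /= !xpair_eqE.
by case: i; case: j; rewrite ?ent0 ?ent1 ?xpair_eqE /= ?andbT ?andbF.
Qed.

(* Halmos' unitary dilation; the square roots of the defect operators
   1 - v v^* and 1 - v^* v of a partial isometry v are these projections
   themselves. *)
Definition halmos (v : op R (T * O)%type) :=
  blockop v (1%:M - v *m v ^t*) (1%:M - v ^t* *m v) (- v ^t*).

(** The hypothesis makes v v^* and v^* v projections, so the defect blocks are idempotent and
    complete the diagonal blocks to 1; they annihilate v and its adjoint, which kills the
    off-diagonal blocks. *)
Lemma halmos_unitary v : v *m v ^t* *m v = v -> halmos v \is unitarymx.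
Proof.
move=> vvv; apply/unitarymxP; rewrite /halmos blockop_adj dagN !dagB !dag1 !dagM dagK.
have vvv' : v ^t* *m v *m v ^t* = v ^t*.
  by rewrite -[RHS](congr1 (fun w => w ^t*) vvv) !dagM dagK mulmxA.
have idem (P : op R (T * O)%type) :
    P *m P = P -> (1%:M - P) *m (1%:M - P) = 1%:M - P.
  by move=> PP; rewrite mulmxBr mulmx1 mulmxBl mul1mx PP subrr subr0.
rewrite blockop_mul !idem ?mulmxA ?vvv ?vvv' //.
rewrite addrC subrK !mulmxBr !mulmxBl !mulmx1 !mul1mx !mulmxN !mulNmx.
by rewrite !opprK !mulmxA vvv vvv' !subrr !addNr !addr0 subrK blockop1.
Qed.

Definition diagop (U : finType) (p : pred U) : op R U :=
  mkop (fun x y => ((x == y) && p x)%:R).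

Lemma ent_diagopM (U : finType) (p : pred U) (X : op R U) x y :
  ent (diagop p *m X) x y = (p x)%:R * ent X x y.
Proof.
rewrite entM (bigD1 x) //= mkopE eqxx big1 ?addr0 // => z nz.
by rewrite mkopE eq_sym (negPf nz) mul0r.
Qed.

Lemma diagop_projective (U I : finType) (f : U -> I) :
  projective_measurement (fun k : I => diagop [pred x | f x == k]).
Proof.
split.
- move=> k; apply: opP => x y; rewrite ent_adj !mkopE rmorph_nat eq_sym /=.
  by case: eqP => // ->.
- move=> k; apply: opP => x y; rewrite ent_diagopM !mkopE /= -natrM mulnb.
  by rewrite andbCA andbb.
- apply: opP => x y; rewrite ent_sum ent1 (bigD1 (f x)) //= mkopE /= eqxx andbT.
  by rewrite big1 ?addr0 // => k nk; rewrite mkopE /= [f x == k]eq_sym (negPf nk) andbF.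
Qed.

Variables (M : O -> op R T) (o0 : O).
Hypothesis cM : kraus_complete M.

(** The Stinespring isometry, sending x next to [o0] to the sum over k of M_k x next to k, extended
    by 0 to the other ancilla states. *)
Definition kraus_iso : op R (T * O)%type :=
  mkop (fun x y => (y.2 == o0)%:R * ent (M x.2) x.1 y.1).

Lemma kraus_iso_adjM : kraus_iso ^t* *m kraus_iso = tensop 1%:M (ketbra R o0).
Proof.
apply: opP => -[x o] [y p]; rewrite entM mkopE /= ent_ketbra -cM ent_sum.
transitivity (\sum_(k : O) \sum_(z : T) (o == o0)%:R * (p == o0)%:R *
    ((ent (M k) z x)^* * ent (M k) z y)).
  rewrite exchange_big pair_bigA; apply: eq_bigr => -[z k] _.
  by rewrite ent_adj !mkopE /= rmorphM rmorph_nat mulrACA.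
rewrite -mulnb natrM [RHS]mulrC mulr_sumr; apply: eq_bigr => k _.
by rewrite entM mulr_sumr; apply: eq_bigr => z _; rewrite ent_adj.
Qed.

(** By completeness v^* v is the projection onto ancilla state [o0], the only state on which v is
    nonzero; so v is a partial isometry, as [halmos_unitary] requires. *)
Lemma kraus_isoK : kraus_iso *m kraus_iso ^t* *m kraus_iso = kraus_iso.
Proof.
rewrite -mulmxA kraus_iso_adjM; apply: opP => -[x o] [y p]; rewrite entM.
rewrite (bigD1 (y, p)) //= [X in _ + X]big1 ?addr0 => [|[z q] nz].
  rewrite !mkopE /= ent1 ent_ketbra eqxx mul1r andbb mulrAC -natrM mulnb.
  by rewrite andbb.
rewrite !mkopE /= ent1 ent_ketbra; move: nz; rewrite xpair_eqE.
case: (z =P y) => [->|_ _]; last by rewrite mul0r mulr0.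
case: (q =P o0) => [->|_ _]; last by rewrite !mul0r.
by rewrite /= eq_sym => /negPf ->; rewrite !mulr0.
Qed.

(** On the initial ancilla state the defect block 1 - v^* v vanishes, so the bit stays [false] and
    only the block v contributes; projecting onto outcome k selects [M k]. *)
Lemma dilation_outcome k x o y :
  ent (diagop [pred z | z.2.1 == k] *m halmos kraus_iso) (x, o) (y, (o0, false)) =
  (o == (k, false))%:R * ent (M k) x y.
Proof.
case: o => o b; rewrite ent_diagopM mkopE /= xpair_eqE.
case: b => /=; last first.
  by rewrite mkopE /= eqxx mul1r eqbF_neg andbT; case: eqP => [->|]; rewrite ?mul0r.
rewrite kraus_iso_adjM entB mkopE /= !ent1 ent_ketbra eqxx andbT xpair_eqE.
by rewrite -natrM mulnb subrr mulr0 andbF mul0r.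
Qed.

End Dilation.

(** * Symmetric simulation of whole LOCC protocols *)

Section LoccSimulation.
Variables (R : realType) (m : nat) (gT : 'I_m -> finGroupType).
Variable H : {group {dffun forall i, gT i}}.
Implicit Types A B C K O : 'I_m -> finType.

(** Only the columns of [V i] at the initial ancilla state [s i] matter. When these end in a single
    state [t i], the ancilla remains in a pure product state and can be discarded without disturbing
    the system. *)
Lemma conjop_introduce_ketbra A K (V : forall i, op R (adjoin A K i))
    (M : forall i, op R (A i)) (s t : glob K) (X : gop R A) :
  (forall i x k y, ent (V i) (x, k) (y, s i) = (k == t i)%:R * ent (M i) x y) ->
  conjop (tens V) (introduce (tens (fun i => ketbra R (s i))) X) =
  introduce (tens (fun i => ketbra R (t i))) (conjop (tens M) X).
Proof.
move=> VM.
have gVM x k y : ent (tens V) (gpair x k) (gpair y s) =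
    (k == t)%:R * ent (tens M) x y.
  rewrite !ent_tens glob_eq -big_split /=; apply: eq_bigr => i _.
  by rewrite !ffunE VM.
apply: gopP => x k y l; rewrite ent_introduce !ent_conjop ent_tens_ketbra.
rewrite glob_pair_sum mulr_suml; apply: eq_bigr => x' _.
rewrite (bigD1 s) //= [X in _ + X]big1 ?addr0 => [|s' /negPf ns]; last first.
  rewrite glob_pair_sum big1 // => z _; rewrite big1 // => s'' _.
  by rewrite ent_introduce ent_tens_ketbra ns /= !mulr0 mul0r.
rewrite glob_pair_sum mulr_suml; apply: eq_bigr => y' _.
rewrite (bigD1 s) //= [X in _ + X]big1 ?addr0 => [|s' /negPf ns]; last first.
  by rewrite ent_introduce ent_tens_ketbra ns andbF !mulr0 mul0r.
rewrite ent_introduce ent_tens_ketbra !eqxx !gVM rmorphM rmorph_nat.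
by rewrite mulr1 -[in RHS]mulnb [in RHS]natrM; ring.
Qed.

Lemma discard_introduce_ketbra A K (t : glob K) (X : gop R A) :
  discard (introduce (tens (fun i => ketbra R (t i))) X) = X.
Proof.
apply: opP => x y; rewrite ent_discard (bigD1 t) //=.
rewrite ent_introduce ent_tens_ketbra !eqxx mulr1 big1 ?addr0 // => k /negPf nk.
by rewrite ent_introduce ent_tens_ketbra nk mulr0.
Qed.

Lemma simulable_kraus A O B (M : forall i, O i -> op R (A i))
    (Phi : glob O -> gop R A -> gop R B) :
  (forall i, kraus_complete (M i)) -> inhabited (glob O) ->
  (forall k, simulable H (Phi k)) ->
  simulable H (fun X =>
    \sum_(k : glob O) Phi k (conjop (tens (fun i => M i (k i))) X)).
Proof.
move=> cM [o] sPhi; pose K i : finType := (O i * bool)%type.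
(* This serves both as the initial ancilla state, [anc o], and as the one left behind by outcome
   [k]; the bit is [false] in both. *)
pose anc (k : glob O) : glob K := finfun (fun i => (k i, false) : K i).
pose W i : op R (adjoin A K i) := halmos (kraus_iso (M i) (o i)).
pose P i k : op R (adjoin A K i) := diagop R [pred z | z.2.1 == k].
have sk k : simulable H (fun X : gop R (adjoin A K) => Phi k (discard X)).
  exact: simulable_comp (@simulable_discard _ _ _ H A K) (sPhi k).
have sP := simulable_projective (P := P) (fun i => diagop_projective R _) sk.
have uW i : W i \is unitarymx by exact/halmos_unitary/kraus_isoK.
have sI : simulable H (introduce (A := A) (tens (fun i => ketbra R (anc o i)))).
  by apply: simulable_state => i; exact: density_ketbra.
have sW : simulable H (conjop (tens W)) by exact: simulable_unitary.
have sT := simulable_comp sI (simulable_comp sW sP).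
apply: simulable_ext sT _ => X /=.
apply: eq_bigr => k _; congr (Phi k _).
rewrite conjop_comp tensM (conjop_introduce_ketbra (t := anc k)
  (M := fun i => M i (k i))) ?discard_introduce_ketbra // => i x l y.
by rewrite !ffunE dilation_outcome.
Qed.

Lemma locc_simulable A B (Phi : gop R A -> gop R B) :
  locc Phi -> (forall i, (0 < #|A i|)%N) -> simulable H Phi.
Proof.
elim=> {A Phi}.
- by move=> _; exact: simulable_id.
- move=> A A' f Phi bf _ IH A0.
  apply: simulable_comp (simulable_relabel bf) (IH _) => i.
  by rewrite (bij_eq_card (bf i)).
- move=> A K rho Phi drho _ IH A0.
  apply: simulable_comp (simulable_state drho) (IH _) => i.
  by rewrite /adjoin card_prod muln_gt0 A0 (density_card (drho i)).
- move=> A u Phi uu _ IH A0.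
  exact: simulable_comp (simulable_unitary uu) (IH A0).
- move=> A O M Phi cM _ IH A0.
  exact: simulable_kraus cM (kraus_glob cM A0) (fun k => IH k A0).
- move=> A K Phi _ IH AK0.
  apply: simulable_comp (@simulable_discard _ _ _ H A K) (IH _) => i.
  by have := AK0 i; rewrite /adjoin card_prod muln_gt0 => /andP[].
Qed.

End LoccSimulation.

(** * The controlled swap *)

Section ControlledSwap.
Variables (R : realType) (G : finGroupType) (A : prep R G).

(* Controlled on the register value g, the swap of the first and the last
   factor conjugated by [rep A g] on the first one. *)
Definition cswap : op R (A * G * A)%type :=
  mkop (fun x y => (x.1.2 == y.1.2)%:R *
    (ent (rep A x.1.2) x.1.1 y.2 * (ent (rep A x.1.2) y.1.1 x.2)^*)).

(** Each register block is a unitary conjugate of a swap, hence unitary and its own inverse; so the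
    same operator serves in [encode] and in [decode]. *)
Lemma cswap_unitary : cswap \is unitarymx.
Proof.
apply/unitarymxP; apply: opP => -[[a g] t] [[b h] s]; rewrite entM ent1.
transitivity (\sum_(p : A * G) \sum_(t' : A) (g == p.2)%:R * (h == p.2)%:R *
    ((ent (rep A g) a t' * (ent (rep A h) b t')^*) *
     ((ent (rep A g) p.1 t)^* * ent (rep A h) p.1 s))).
  rewrite pair_bigA; apply: eq_bigr => -[[a' g'] t'] _ /=.
  by rewrite ent_adj !mkopE /= !rmorphM /= conjCK rmorph_nat; ring.
rewrite sum_prod exchange_big (bigD1 h) //= [X in _ + X]big1 ?addr0; last first.
  move=> g' /negPf nh; rewrite big1 // => a' _; rewrite big1 // => t' _.
  by rewrite [h == _]eq_sym nh mulr0 mul0r.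
rewrite eqxx mulr1 !xpair_eqE; case: eqP => [->|_]; last first.
  by rewrite andbF big1 // => a' _; rewrite big1 // => t' _; rewrite mul0r.
rewrite andbT -mulnb natrM -!ent1.
rewrite -{1}(unitarymxP (rep_unitary A h)) -(unitary_adjl (rep_unitary A h)).
rewrite !entM big_distrlr exchange_big /=; apply: eq_bigr => t' _.
by apply: eq_bigr => a' _; rewrite !ent_adj mul1r.
Qed.

(** Translating the register by g replaces U(y) by U(gy), a phase times U(g) U(y). The vector
    leaving the trivial slot is hit by U(gy) and the one entering it by the adjoint of U(gy), so the
    phase meets its conjugate and cancels; in the second case U(gy)^* U(g) is U(y)^* up to that
    phase, whence the trivial action on the last factor. *)
Lemma cswap_commute g :
  tensop (tensop (rep A g) (reg_rep R g)) 1%:M *m cswap =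
  cswap *m tensop (tensop (rep A g) (reg_rep R g)) 1%:M.
Proof.
apply: opP => -[[a x] t] [[b y] s]; rewrite !entM.
have [c c1 Uc] := rep_mul A g y.
transitivity ((x == (g * y)%g)%:R *
    (ent (rep A g *m rep A y) a s * (ent (rep A y) b t)^*)).
  rewrite sum_prod exchange_big (bigD1 t) //= [X in _ + X]big1 ?addr0; last first.
    move=> t' /negPf nt; rewrite big1 // => p _.
    by rewrite mkopE /= ent1 eq_sym nt mulr0 mul0r.
  rewrite sum_prod exchange_big (bigD1 y) //= [X in _ + X]big1 ?addr0; last first.
    move=> x' /negPf nx; rewrite big1 // => p _.
    by rewrite [X in _ * X]mkopE /= nx mul0r mulr0.
  rewrite entM mulr_suml mulr_sumr; apply: eq_bigr => a' _.
  by rewrite !mkopE /= ent1 !eqxx /=; ring.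
rewrite [RHS]sum_prod [RHS]exchange_big (bigD1 s) //= [X in _ + X]big1 ?addr0; last first.
  move=> t' /negPf nt; rewrite big1 // => p _.
  by rewrite [X in _ * X]mkopE /= ent1 nt mulr0 mulr0.
rewrite [RHS]sum_prod [RHS]exchange_big (bigD1 x) //= [X in _ + X]big1 ?addr0; last first.
  move=> x' /negPf nx; rewrite big1 // => p _.
  by rewrite mkopE /= eq_sym nx !mul0r.
transitivity ((x == (g * y)%g)%:R *
    (ent (rep A x) a s * (ent ((rep A g) ^t* *m rep A x) b t)^*)); last first.
  rewrite entM rmorph_sum !mulr_sumr; apply: eq_bigr => a' _.
  by rewrite !mkopE /= ent1 !eqxx ent_adj rmorphM /= conjCK; ring.
case: eqP => [->|_]; last by rewrite !mul0r.
congr (_ * _).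
have -> : (rep A g) ^t* *m rep A (g * y)%g = c^* *: rep A y.
  have -> : rep A (g * y)%g = c^* *: (rep A g *m rep A y).
    by rewrite Uc scalerA mulrC -normCK c1 expr1n scale1r.
  by rewrite -scalemxAr mulmxA unitary_adjl ?rep_unitary // mul1mx.
by rewrite Uc !entZ rmorphM /= conjCK; ring.
Qed.

End ControlledSwap.

(** * Encoding, decoding and exact implementation *)

Section Implementation.
Variables (R : realType) (m : nat) (gT : 'I_m -> finGroupType).
Variable H : {group {dffun forall i, gT i}}.
Implicit Types A B : systems R gT.
Local Notation reg := (registers R gT).
Local Notation prim := (prim H (free_Gamma H)).

Definition framed A : 'I_m -> finType :=
  adjoin (adjoin (basis A) (basis reg)) (basis A).

Definition gcswap A : gop R (framed A) := tens (fun i => cswap (A i)).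

Definition gmixed A : gop R (basis A) := tens (fun i => mixed R (A i)).

Lemma ent_gcswap A a (g : glob (basis reg)) t a' (g' : glob (basis reg)) t' :
  ent (gcswap A) (gpair (gpair a g) t) (gpair (gpair a' g') t') =
  (g == g')%:R * (ent (grep A g) a t' * (ent (grep A g) a' t)^*).
Proof.
rewrite !ent_tens glob_eq rmorph_prod -!big_split /=.
by apply: eq_bigr => i _; rewrite mkopE !ffunE.
Qed.

(** The swap is block diagonal in the register, so the block at (g, g) of the result depends on that
    block of [M] alone. It need be a product only there, which allows [M] to be correlated with the
    register. *)
Lemma conjop_gcswap A (M : gop R (framed A)) (X Y : gop R (basis A))
    (g : glob (basis reg)) a t b s :
  (forall a' t' b' s', ent M (gpair (gpair a' g) t') (gpair (gpair b' g) s') =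
    ent X a' b' * ent Y t' s') ->
  ent (conjop (gcswap A) M) (gpair (gpair a g) t) (gpair (gpair b g) s) =
  ent (conjop (grep A g) Y) a b * ent (conjop ((grep A g) ^t*) X) t s.
Proof.
move=> MXY; rewrite !ent_conjop.
have red (x : glob (basis A)) (y : glob (basis A)) (F : glob (framed A) -> R[i]) :
  \sum_z ent (gcswap A) (gpair (gpair x g) y) z * F z =
  \sum_a' \sum_t' ent (grep A g) x t' * (ent (grep A g) a' y)^* *
    F (gpair (gpair a' g) t').
  rewrite glob_pair_sum glob_pair_sum; apply: eq_bigr => a' _.
  rewrite (bigD1 g) //= [X in _ + X]big1 ?addr0; last first.
    move=> g' /negPf ng; rewrite big1 // => t' _.
    by rewrite ent_gcswap eq_sym ng !mul0r.
  by apply: eq_bigr => t' _; rewrite ent_gcswap eqxx mul1r.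
transitivity (\sum_z ent (gcswap A) (gpair (gpair a g) t) z *
    (\sum_w ent (gcswap A) (gpair (gpair b g) s) w * (ent M z w)^*)^*).
  apply: eq_bigr => z _; rewrite rmorph_sum mulr_sumr; apply: eq_bigr => w _.
  by rewrite rmorphM /= conjCK; ring.
rewrite red big_distrlr /= [RHS]exchange_big /=.
transitivity (\sum_a' \sum_t' \sum_b' \sum_s'
  (ent (grep A g) a t' * ent Y t' s' * (ent (grep A g) b s')^*) *
  ((ent (grep A g) a' t)^* * ent X a' b' * ent (grep A g) b' s)).
  apply: eq_bigr => a' _; apply: eq_bigr => t' _; rewrite red.
  rewrite rmorph_sum mulr_sumr; apply: eq_bigr => b' _.
  rewrite rmorph_sum mulr_sumr; apply: eq_bigr => s' _.
  by rewrite MXY !rmorphM /= !conjCK; ring.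
apply: eq_bigr => a' _; apply: eq_bigr => t' _.
rewrite exchange_big big_distrlr /=; apply: eq_bigr => s' _; apply: eq_bigr => b' _.
by rewrite !ent_adj conjCK.
Qed.

Lemma ent_Gamma (g : glob (basis reg)) :
  ent (Gamma R H) g g = (g \in H)%:R * (#|H|%:R)^-1.
Proof.
rewrite entZ ent_sum mulrC; congr (_ * _).
under eq_bigr => h _ do rewrite (ent_tens_ketbra R (A := basis reg)) andbb.
rewrite big_mkcond /= (bigD1 g) //= eqxx big1 ?addr0; first by case: (g \in H).
by move=> h nh; rewrite [g == h]eq_sym (negPf nh); case: ifP.
Qed.

Definition flip (T U V : Type) (z : T * U * V) : V * U * T :=
  (z.2, z.1.2, z.1.1).

Lemma flip_bij (T U V : Type) : bijective (@flip T U V).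
Proof. by exists (@flip V U T) => -[[]]. Qed.

Definition gflip A (Z : gop R (framed A)) : gop R (framed A) :=
  relabel (fun i => @flip (A i) (gT i) (A i)) Z.

Lemma ent_gflip A Z t g a s h b :
  ent (gflip (A := A) Z) (gpair (gpair t g) a) (gpair (gpair s h) b) =
  ent Z (gpair (gpair a g) t) (gpair (gpair b h) s).
Proof.
by rewrite ent_relabel; congr (ent Z _ _); apply/ffunP => i; rewrite !ffunE.
Qed.

(* The state of the system, rotated back by the shared group element, moves to
   a copy of the system on which the symmetry acts trivially. *)
Definition encode A (X : gop R (basis A)) : gop R (adjoin (basis A) (basis reg)) :=
  discard (gflip (conjop (gcswap A)
    (introduce (gmixed A) (introduce (Gamma R H) X)))).

(** [gflip] comes before the swap here because [gcswap] expects the covariant system first and the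
    trivial one last. *)
Definition decode B (Z : gop R (adjoin (basis B) (basis reg))) : gop R (basis B) :=
  discard (discard (conjop (gcswap B) (gflip (introduce (gmixed B) Z)))).

Lemma conjop_gmixed_trace A (U : gop R (basis A)) :
  (forall i, (0 < #|A i|)%N) -> U \is unitarymx ->
  \tr (conjop U (gmixed A)) = 1.
Proof.
move=> A0 uU; rewrite conjop_trace // tens_trace big1 // => i _.
by case: (density_mixed R (A0 i)).
Qed.

(** Diagonal slices suffice because [decode] discards the register. After the swap the original slot
    holds a rotated maximally mixed state, and discarding it contributes a factor 1. *)
Lemma slice_encode A (X : gop R (basis A)) (g : glob (basis reg)) :
  (forall i, (0 < #|A i|)%N) ->
  slice (encode X) g g =
  ((g \in H)%:R * (#|H|%:R)^-1) *: conjop ((grep A g) ^t*) X.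
Proof.
(* The weight of g in [Gamma] is absorbed into [X], so that the register block becomes a product as
   [conjop_gcswap] demands. *)
move=> A0; rewrite -ent_Gamma; set c := ent _ g g; rewrite -conjopZr.
apply: opP => t s; rewrite ent_slice ent_discard.
transitivity (\sum_a ent (conjop (grep A g) (gmixed A)) a a *
    ent (conjop ((grep A g) ^t*) (c *: X)) t s).
  apply: eq_bigr => a _; rewrite ent_gflip; apply: conjop_gcswap => a' t' b' s'.
  by rewrite !ent_introduce entZ; congr (_ * _); rewrite mulrC.
rewrite -mulr_suml -ent_trace conjop_gmixed_trace ?mul1r //.
exact: grep_unitary.
Qed.

Lemma decodeE B (Z : gop R (adjoin (basis B) (basis reg))) :
  (forall i, (0 < #|B i|)%N) ->
  decode Z = \sum_(g : glob (basis reg)) conjop (grep B g) (slice Z g g).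
Proof.
move=> B0; apply: opP => a b; rewrite ent_discard ent_sum.
apply: eq_bigr => g _; rewrite ent_discard.
transitivity (\sum_t ent (conjop (grep B g) (slice Z g g)) a b *
    ent (conjop ((grep B g) ^t*) (gmixed B)) t t).
  apply: eq_bigr => t _; apply: conjop_gcswap => a' t' b' s'.
  by rewrite ent_gflip ent_introduce ent_slice mulrC.
rewrite -mulr_sumr -ent_trace conjop_gmixed_trace ?mulr1 //.
exact/dag_unitary/grep_unitary.
Qed.

Lemma decode_encode A B (E : gop R (basis A) -> gop R (basis B)) X :
  covLOCC H E -> (forall i, (0 < #|A i|)%N) ->
  decode (ext (S := basis reg) E (encode X)) = E X.
Proof.
move=> [lE cE] A0; have B0 := locc_nonempty lE A0; rewrite decodeE //.
transitivity (\sum_(g in H) (#|H|%:R)^-1 *: E X).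
  (* [decodeE] sums over all register values; off [H] the slice is 0, and [E] maps it to 0 by
     linearity. *)
  rewrite [RHS]big_mkcond; apply: eq_bigr => g _.
  rewrite slice_ext slice_encode //; case: ifP => Hg; last first.
    by rewrite mul0r scale0r (locc0 lE) /conjop mulmx0 mul0mx.
  by rewrite mul1r loccZ // conjopZr -cE // conjop_unitaryK // grep_unitary.
rewrite sumr_const -scaler_nat scalerA mulfV ?scale1r //.
by rewrite pnatr_eq0 -lt0n cardG_gt0.
Qed.

Lemma mixed_invariant A i : invariant_op H (mixed R (A i)).
Proof. by move=> g _; rewrite -scalemxAr -scalemxAl mul1mx mulmx1. Qed.

Lemma prim_encode A C (Psi : gop R (basis (sadjoin (triv R gT (basis A)) reg)) ->
    gop R (basis C)) :
  (forall i, (0 < #|A i|)%N) -> prim Psi ->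
  prim (fun X : gop R (basis A) => Psi (encode X)).
Proof.
move=> A0 pPsi; set T := triv R gT (basis A).
(* The tree grows from its last step backwards, each constructor prefixing one step. *)
have p1 := prim_discard A pPsi.
have p2 := prim_relabel (A := sadjoin (sadjoin A reg) T)
  (A' := sadjoin (sadjoin T reg) A)
  (f := fun i => @flip (A i) (gT i) (A i)) (fun i => flip_bij _ _ _) _ p1.
have p3 := prim_unitary (A := sadjoin (sadjoin A reg) T)
  (u := fun i => cswap (A i)) (fun i => cswap_unitary _)
  (fun i g _ => cswap_commute _ _) (p2 _).
have p4 := prim_state (A := sadjoin A reg) (K := T)
  (rho := fun i => mixed R (A i)) (fun i => density_mixed R (A0 i))
  (fun i => triv_invariant (A := basis A) _) (p3 _).
have p5 := prim_free (FreeGamma R H) (p4 _).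
(* What remains is that [flip] intertwines the two tensor product representations. *)
apply: p5 => i g [[x k] s] [[y l] t].
rewrite !mkopE /= !ent1.
by ring.
Qed.

Lemma prim_decode B :
  (forall i, (0 < #|B i|)%N) ->
  prim (A := sadjoin (triv R gT (basis B)) reg) (B := B) (@decode B).
Proof.
move=> B0; set T := triv R gT (basis B).
have p0 := prim_discard (A := B) reg (prim_done H (@free_Gamma R m gT H) B).
have p1 := prim_discard T p0.
have p2 := prim_unitary (A := sadjoin (sadjoin B reg) T)
  (u := fun i => cswap (B i)) (fun i => cswap_unitary _)
  (fun i g _ => cswap_commute _ _) p1.
have p3 := prim_relabel (A := sadjoin (sadjoin T reg) B)
  (A' := sadjoin (sadjoin B reg) T)
  (f := fun i => @flip (B i) (gT i) (B i)) (fun i => flip_bij _ _ _) _ p2.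
have p4 := prim_state (A := sadjoin T reg) (K := B)
  (rho := fun i => mixed R (B i)) (fun i => density_mixed R (B0 i))
  (@mixed_invariant B) (p3 _).
apply: p4 => i g [[x k] s] [[y l] t].
by rewrite !mkopE /= !ent1; ring.
Qed.

(* On a zero-dimensional system the measurement with no outcome is allowed. *)
Lemma prim_degenerate A B (E : gop R (basis A) -> gop R (basis B)) i0 :
  #|A i0| = 0%N -> E 0 = 0 -> prim E.
Proof.
(* The boolean is read as a cardinality: one trivial outcome at a party with nonempty basis, none at
   the others. At [i0] there is none, so the sum over joint outcomes is empty. *)
move=> A0 E0; pose O i : finType := 'I_(0 < #|A i|)%N.
have noO (k : glob O) : False by case: (k i0) => j; rewrite A0.
have pm := prim_measure (H := H) (free := @free_Gamma R m gT H) (B := B)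
  (A := A) (O := O) (P := fun i _ => 1%:M) (Phi := fun _ _ => 0) _ _ _.
apply: prim_ext (pm _ _ _) _.
- move=> i; split=> [k|k|]; rewrite ?dag1 ?mulmx1 //.
  apply: opP => x y; rewrite sumr_const card_ord (_ : (0 < #|A i|)%N) //.
  by apply/card_gt0P; exists x.
- by move=> i k g _; rewrite mul1mx mulmx1.
- by move=> k; case: (noO k).
- move=> X; rewrite big1 // -E0; congr E; apply: opP => x.
  by have := card0_eq A0 (x i0).
Qed.

Lemma covLOCC_prim A B (E : gop R (basis A) -> gop R (basis B)) :
  covLOCC H E -> prim E.
Proof.
move=> cE; have lE : locc E by case: cE.
(* [mixed] has trace 1 only on a nonempty basis, hence the separate treatment of zero-dimensional
   systems. *)
have [A0|] := boolP [forall i, (0 < #|A i|)%N]; last first.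
  case/forallPn=> i; rewrite -eqn0Ngt => /eqP A0.
  exact: prim_degenerate A0 (locc0 lE).
move/forallP: A0 => A0; have B0 := locc_nonempty lE A0.
have sE : simulable H E by exact: locc_simulable.
apply: prim_ext (prim_encode A0 (sE _ reg _ (prim_decode B0))) _ => X.
exact: decode_encode.
Qed.

End Implementation.

Theorem proposition1 (R : realType) (m : nat) (gT : 'I_m -> finGroupType)
    (H : {group {dffun forall i, gT i}}) :
  (forall (A B : systems R gT) (E : gop R (basis A) -> gop R (basis B)),
     covLOCC H E -> prim H (free_Gamma H) E)
  /\ (forall (A B : systems R gT) (E : gop R (basis A) -> gop R (basis B)),
        prim H (free_Gamma H) E <-> covLOCC H E).
Proof.
split=> A B E; first exact: covLOCC_prim.
split=> [pE|]; last exact: covLOCC_prim.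
by split; [exact: prim_locc pE | exact: prim_covariant].
Qed.
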